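(* Let $A,M\in\mathbb{R}^{n\times n}$ be symmetric positive definite, with the block splitting $n=n_1+n_2$ described in the context. Let $\Lambda>0$, $\gamma>1$, $\tilde\Lambda=\gamma\Lambda$, let $N\ge 1$ be an integer, and let $$\xi_i=\frac{\Lambda}{2}\Big[1+\cos\Big(\frac{2i-1}{2N}\pi\Big)\Big],\qquad i=1,\dots,N,$$ be the Chebyshev interpolation points of $(0,\Lambda)$. Let $V_2=\mathrm{range}(P_{\tilde\Lambda})\oplus W_2\subset\mathbb{R}^{n_2}$ and $$V=\Big\{\begin{bmatrix}\mathbf v_1\\ \mathbf v_2\end{bmatrix}:\ \mathbf v_1\in\mathbb{R}^{n_1},\ \mathbf v_2\in V_2\Big\},$$ where $P_{\tilde\Lambda}$ and $W_2$ are as defined in the context. Then for any $\lambda\in\sigma(A,M)\cap(0,\Lambda)$ there exists $\tilde\lambda\in\sigma_V(A,M)$ such that $$\frac{|\lambda-\tilde\lambda|}{\lambda}\le C_M\,C(\lambda)\,\Lambda\,(4\gamma)^3\Big(\frac{1}{4(\gamma-1)}\Big)^{2N+2},$$ where $C_M$ and $C(\lambda)=C(\lambda;A,M,V)$ are the positive constants defined in the context.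
   Context: Block splitting: $A=\begin{bmatrix} A_{11} & A_{12} \\ A_{21} & A_{22} \end{bmatrix}$, $M=\begin{bmatrix} M_{11} & M_{12} \\ M_{21} & M_{22} \end{bmatrix}$ with $A_{ij},M_{ij}\in\mathbb{R}^{n_i\times n_j}$; vectors are split as $\mathbf x=[\mathbf x_1\ \mathbf x_2]^T$, $\mathbf x_i\in\mathbb{R}^{n_i}$. Spectrum: $\sigma(A,M)=\{z\in\mathbb{C}: A-zM\text{ is not invertible}\}$. For a subspace $V=\mathrm{range}(Q)$, with $Q$ having linearly independent columns, $\sigma_V(A,M):=\sigma(Q^TAQ,Q^TMQ)$ (independent of the choice of $Q$). Norms: for a symmetric positive definite matrix $S$, $\|\mathbf x\|_S=(\mathbf x^TS\mathbf x)^{1/2}$. Standing assumption: all eigenvalues in $\sigma(A,M)$ are simple. For $\lambda\in\sigma(A,M)$ let $\mathbf x$ denote an eigenvector, $A\mathbf x=\lambda M\mathbf x$, normalised by $\mathbf x^TM\mathbf x=1$. Constant $C(\lambda)$: $C(\lambda)=C(\lambda;A,M,V)>0$ denotes a constant for which the Rayleigh--Ritz best approximation estimate holds, i.e. there exists $\tilde\lambda\in\sigma_V(A,M)$ with $\frac{|\lambda-\tilde\lambda|}{\lambda}\le C(\lambda)\min_{\mathbf v\in V}\|\mathbf x-\mathbf v\|_A^2$. Constant $C_M$: $C_M^{-1}:=\min\{\eta>0:\ \eta\in\sigma(I-M_{22}^{-1/2}M_{12}^TM_{11}^{-1}M_{12}M_{22}^{-1/2})\}$, where $\sigma(\cdot)$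 with one argument is the usual matrix spectrum. Exterior eigenpairs: $(\mu_k,\mathbf v_k)$, $k=1,\dots,n_2$, satisfy $A_{22}\mathbf v_k=\mu_kM_{22}\mathbf v_k$ and $\mathbf v_j^TM_{22}\mathbf v_k=\delta_{jk}$. Projection: $P_{\tilde\Lambda}:=\sum_{\{k:\ \mu_k\in(0,\tilde\Lambda)\}}\mathbf v_k\mathbf v_k^TM_{22}\in\mathbb{R}^{n_2\times n_2}$. Function $f_{\tilde\Lambda}$: $f_{\tilde\Lambda}(\xi):=(I-P_{\tilde\Lambda})(A_{22}-\xi M_{22})^{-1}$ for $\xi\in(0,\Lambda)\setminus\sigma(A_{22},M_{22})$, extended analytically to all of $(0,\tilde\Lambda)$; explicitly, $f_{\tilde\Lambda}(\xi)M_{22}\mathbf v_k=0$ if $\mu_k<\tilde\Lambda$ and $f_{\tilde\Lambda}(\xi)M_{22}\mathbf v_k=(\mu_k-\xi)^{-1}\mathbf v_k$ otherwise. Complementing subspace: $W_2$ is the linear span of all columns of the matrices $f_{\tilde\Lambda}(\xi_i)\,[M_{21}\ \ A_{21}]$, $i=1,\dots,N$. *)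

(* Defs.v *)
From HB Require Import structures.
From mathcomp Require Import all_boot all_order all_algebra.
From mathcomp Require Import complex.
From mathcomp Require Import all_classical all_reals all_analysis.

Set Implicit Arguments.
Unset Strict Implicit.
Unset Printing Implicit Defensive.

Import Order.TTheory GRing.Theory Num.Theory.

Local Open Scope classical_set_scope.
Local Open Scope ring_scope.

Section Matrices.
Variable R : realType.

Definition spd n (S : 'M[R]_n) : Prop :=
  S^T = S /\ forall x : 'cV[R]_n, x != 0 -> 0 < (x^T *m S *m x) 0 0.

(* Principal square root; the default 0 is only returned if none exists. *)
Definition sqrtmx n (S : 'M[R]_n) : 'M[R]_n :=
  xget 0 [set T | spd T /\ T *m T = S].

Definition mxnorm n (S : 'M[R]_n) (x : 'cV[R]_n) : R :=
  Num.sqrt ((x^T *m S *m x) 0 0).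

(* The default 0 is only returned if X has no minimum. *)
Definition set_min (X : set R) : R := xget 0 [set m | X m /\ lbound X m].

Definition cplx_mx m n (B : 'M[R]_(m, n)) : 'M[R[i]]_(m, n) :=
  map_mx (real_complex R) B.

Definition pencil_spectrum n (A M : 'M[R]_n) : set R[i] :=
  [set z | cplx_mx A - z *: cplx_mx M \notin unitmx].

Definition mx_spectrum n (B : 'M[R]_n) : set R[i] :=
  [set z | eigenvalue (cplx_mx B) z].

(* The multiplicity is that of z as a root of det (A - 'X M). *)
Definition simple_spectrum n (A M : 'M[R]_n) : Prop :=
  forall z, pencil_spectrum A M z ->
    mup z (\det (map_mx polyC (cplx_mx A) - 'X *: map_mx polyC (cplx_mx M)))
      = 1%N.

Definition mxrange m n (B : 'M[R]_(m, n)) : {vspace 'cV[R]_m} :=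
  limg (linfun (mulmx B : 'cV[R]_n -> 'cV[R]_m)).

(* Any matrix Q of linearly independent columns with range V gives the same
   set: see pencil_spectrum_onE. *)
Definition pencil_spectrum_on n (V : {vspace 'cV[R]_n}) (A M : 'M[R]_n) :
    set R[i] :=
  [set z | exists m (Q : 'M[R]_(n, m)),
    [/\ row_free Q^T, mxrange Q = V &
        pencil_spectrum (Q^T *m A *m Q) (Q^T *m M *m Q) z]].

(* c is an admissible constant C(lambda; A, M, V), x being a normalised
   eigenvector for lambda. *)
Definition ritz_constant n (A M : 'M[R]_n) (V : {vspace 'cV[R]_n})
    (lambda : R) (x : 'cV[R]_n) (c : R) : Prop :=
  0 < c /\
  exists2 z : R[i], pencil_spectrum_on V A M z &
    ComplexField.Normc.normc (real_complex R lambda - z) / lambda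
      <= c * set_min [set mxnorm A (x - v) ^+ 2 | v in [set v | v \in V]].

End Matrices.

Section Splitting.
Variables (R : realType) (n1 n2 : nat).

Definition C_M (M : 'M[R]_(n1 + n2)) : R :=
  let M22h := invmx (sqrtmx (drsubmx M)) in
  (set_min [set eta : R | 0 < eta /\
     mx_spectrum
       (1%:M - M22h *m (ursubmx M)^T *m invmx (ulsubmx M) *m ursubmx M *m M22h)
       (real_complex R eta)])^-1.

Definition exterior_eigenpairs (A M : 'M[R]_(n1 + n2))
    (mu : 'I_n2 -> R) (v : 'I_n2 -> 'cV[R]_n2) : Prop :=
  (forall k, drsubmx A *m v k = mu k *: (drsubmx M *m v k)) /\
  (forall j k, ((v j)^T *m drsubmx M *m v k) 0 0 = (j == k)%:R).

Definition Pproj (M : 'M[R]_(n1 + n2)) (mu : 'I_n2 -> R)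
    (v : 'I_n2 -> 'cV[R]_n2) (Lt : R) : 'M[R]_n2 :=
  \sum_(k | 0 < mu k < Lt) v k *m (v k)^T *m drsubmx M.

(* The analytic extension of (I - P) (A22 - xi M22)^-1 to (0, Lt), written in
   the eigenbasis v: see fresE and fres_act. *)
Definition fres (mu : 'I_n2 -> R) (v : 'I_n2 -> 'cV[R]_n2) (Lt xi : R) :
    'M[R]_n2 :=
  \sum_(k | Lt <= mu k) (mu k - xi)^-1 *: (v k *m (v k)^T).

Definition cheb_node (Lambda : R) (N : nat) (i : 'I_N) : R :=
  Lambda / 2 * (1 + cos ((2 * i.+1%:R - 1) / (2 * N%:R) * pi)).

Definition W2 (A M : 'M[R]_(n1 + n2)) (mu : 'I_n2 -> R)
    (v : 'I_n2 -> 'cV[R]_n2) (Lambda Lt : R) (N : nat) : {vspace 'cV[R]_n2} :=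
  <<[seq col j (fres mu v Lt (cheb_node Lambda i)
                  *m row_mx (dlsubmx M) (dlsubmx A))
    | i <- enum 'I_N, j <- enum 'I_(n1 + n1)]>>%VS.

(* The sum is direct: see V2_direct. *)
Definition V2 (A M : 'M[R]_(n1 + n2)) (mu : 'I_n2 -> R)
    (v : 'I_n2 -> 'cV[R]_n2) (Lambda Lt : R) (N : nat) : {vspace 'cV[R]_n2} :=
  (mxrange (Pproj M mu v Lt) + W2 A M mu v Lambda Lt N)%VS.

Definition full_by (U2 : {vspace 'cV[R]_n2}) : {vspace 'cV[R]_(n1 + n2)} :=
  (linfun (dsubmx : 'cV[R]_(n1 + n2) -> 'cV[R]_n2) @^-1: U2)%VS.

End Splitting.

Section Checks.
Variable R : realType.

Lemma mem_full_by n1 n2 (U2 : {vspace 'cV[R]_n2}) (v1 : 'cV[R]_n1) v2 :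
  (col_mx v1 v2 \in full_by n1 U2) = (v2 \in U2).
Proof. by rewrite /full_by -memv_preim lfunE /= col_mxKd. Qed.

Lemma mem_mxrange m n (B : 'M[R]_(m, n)) (u : 'cV[R]_m) :
  reflect (exists w, u = B *m w) (u \in mxrange B).
Proof.
apply: (iffP memv_imgP) => [[w _ ->]|[w ->]]; exists w; rewrite ?lfunE //.
exact: memvf.
Qed.

Lemma mxrange_sub m n p (Q : 'M[R]_(m, n)) (Q' : 'M[R]_(m, p)) :
  (mxrange Q <= mxrange Q')%VS -> (Q^T <= Q'^T)%MS.
Proof.
move=> /subvP sQ; apply/row_subP => j.
have /mem_mxrange[w jw] : col j Q \in mxrange Q'.
  by apply: sQ; apply/mem_mxrange; exists (delta_mx j 0); rewrite -colE.
by rewrite -tr_col jw trmx_mul submxMl.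
Qed.

Lemma pencil_spectrum_onE n m (V : {vspace 'cV[R]_n}) (A M : 'M[R]_n)
    (Q : 'M[R]_(n, m)) :
  row_free Q^T -> mxrange Q = V ->
  pencil_spectrum_on V A M = pencil_spectrum (Q^T *m A *m Q) (Q^T *m M *m Q).
Proof.
move=> fQ VQ; apply/seteqP; split => z /=; last by move=> ?; exists m, Q.
move=> [m' [Q' [fQ' VQ']]].
have s1 : (Q^T <= Q'^T)%MS by apply: mxrange_sub; rewrite VQ VQ'.
have s2 : (Q'^T <= Q^T)%MS by apply: mxrange_sub; rewrite VQ VQ'.
have mm : m' = m.
  apply/eqP; rewrite -(eqP fQ) -(eqP fQ') eqn_leq.
  by rewrite (mxrankS s1) (mxrankS s2).
subst m'.
move: s1 => /submxP[D QD].
have uD : D \in unitmx.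
  rewrite -row_free_unit -row_leq_rank -[X in (X <= _)%N](eqP fQ) QD.
  exact: mxrankM_maxl.
have QD' : Q = Q' *m D^T by rewrite -[Q]trmxK QD trmx_mul trmxK.
rewrite /pencil_spectrum /=; apply: contra.
have -> : cplx_mx (Q^T *m A *m Q) - z *: cplx_mx (Q^T *m M *m Q) =
    cplx_mx D *m (cplx_mx (Q'^T *m A *m Q') - z *: cplx_mx (Q'^T *m M *m Q'))
      *m cplx_mx D^T.
  rewrite mulmxBr mulmxBl -scalemxAr -scalemxAl /cplx_mx -!map_mxM.
  by rewrite QD QD' !mulmxA.
by rewrite !unitmx_mul => /andP[/andP[]].
Qed.

Section Exterior.
Variables (n1 n2 : nat) (A M : 'M[R]_(n1 + n2)).
Variables (mu : 'I_n2 -> R) (v : 'I_n2 -> 'cV[R]_n2).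
Hypothesis spdA : spd A.
Hypothesis ext : exterior_eigenpairs A M mu v.

Let orth j k : (v j)^T *m drsubmx M *m v k = (j == k)%:R%:M.
Proof. by case: ext => _ /(_ j k) h; apply/matrixP => a b; rewrite !ord1 h mxE eqxx. Qed.

Let v_neq0 k : v k != 0.
Proof.
apply/eqP => v0; have := orth k k.
by rewrite v0 mulmx0 eqxx => /matrixP/(_ 0 0)/eqP; rewrite !mxE eqxx eq_sym oner_eq0.
Qed.

Lemma exterior_mu_gt0 k : 0 < mu k.
Proof.
have := spdA.2 (col_mx 0 (v k)); rewrite -[A]submxK tr_col_mx trmx0.
rewrite mul_row_block !mul0mx !add0r mul_row_col mulmx0 add0r.
rewrite -mulmxA ext.1 -scalemxAr mulmxA orth eqxx !mxE eqxx mulr1; apply.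
apply/eqP => /(congr1 dsubmx); rewrite col_mxKd linear0.
by move/eqP; rewrite (negbTE (v_neq0 k)).
Qed.

Lemma exterior_eq m (B C : 'M[R]_(m, n2)) :
  (forall k, B *m v k = C *m v k) -> B = C.
Proof.
move=> h; pose W := \matrix_(i, j) v j i 0.
have colW k : col k W = v k.
  by apply/matrixP => a b; rewrite !mxE ord1.
have WMW : (W^T *m drsubmx M) *m W = 1%:M.
  apply/matrixP => j k; rewrite mxE.
  transitivity (((v j)^T *m drsubmx M *m v k) 0 0); last first.
    by rewrite orth !mxE eqxx.
  rewrite mxE; apply: eq_bigr => i _; rewrite [W _ _]mxE; congr (_ * _).
  by rewrite !mxE; apply: eq_bigr => l _; rewrite !mxE.
have [_ uW] := mulmx1_unit WMW.
rewrite -[B](mulmxK uW) -[C](mulmxK uW); congr (_ *m _).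
apply/trmx_inj/row_matrixP => k.
by rewrite -!tr_col !colE -!mulmxA -!colE colW h.
Qed.

Lemma fres_act Lt xi k :
  fres mu v Lt xi *m (drsubmx M *m v k) =
    if mu k < Lt then 0 else (mu k - xi)^-1 *: v k.
Proof.
rewrite /fres mulmx_suml.
under eq_bigr => j _ do rewrite -scalemxAl -mulmxA (mulmxA _^T) orth mul_mx_scalar.
case: ltP => [ltk|lek].
  rewrite big1 // => j lej; have /negbTE-> : j != k.
    by apply: contraTneq lej => ->; rewrite -ltNge.
  by rewrite scale0r scaler0.
rewrite (bigD1 k) //= eqxx scale1r big1 ?addr0 // => j /andP[_ /negbTE->].
by rewrite scale0r scaler0.
Qed.

Lemma Pproj_act Lt k :
  Pproj M mu v Lt *m v k = if mu k < Lt then v k else 0.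
Proof.
rewrite /Pproj mulmx_suml.
under eq_bigr => j _ do rewrite -!mulmxA (mulmxA _^T) orth mul_mx_scalar.
case: ltP => [ltk|lek].
  rewrite (bigD1 k) /= ?exterior_mu_gt0 // eqxx scale1r big1 ?addr0 //.
  by move=> j /andP[_ /negbTE->]; rewrite scale0r.
rewrite big1 // => j /andP[_ ltj]; have /negbTE-> : j != k.
  by apply: contraTneq ltj => ->; rewrite -leNgt.
by rewrite scale0r.
Qed.

Lemma fresE Lt xi : 0 < xi < Lt ->
  drsubmx A - xi *: drsubmx M \in unitmx ->
  fres mu v Lt xi =
    (1%:M - Pproj M mu v Lt) *m invmx (drsubmx A - xi *: drsubmx M).
Proof.
move=> /andP[_ ltxi] u; apply/(canRL (mulmxK u))/exterior_eq => k.
rewrite -mulmxA mulmxBl ext.1 -scalemxAl -scalerBl -scalemxAr fres_act.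
rewrite mulmxBl mul1mx Pproj_act; case: ltP => [_|lek].
  by rewrite scaler0 subrr.
by rewrite scalerA divff ?scale1r ?subr0 // subr_eq0 gt_eqF // (lt_le_trans ltxi).
Qed.

Lemma V2_direct Lambda Lt N :
  (mxrange (Pproj M mu v Lt) :&: W2 A M mu v Lambda Lt N = 0)%VS.
Proof.
have PP : Pproj M mu v Lt *m Pproj M mu v Lt = Pproj M mu v Lt.
  apply: exterior_eq => k; rewrite -mulmxA Pproj_act.
  by case: ifP => h; rewrite ?mulmx0 // Pproj_act h.
have Pf xi : Pproj M mu v Lt *m fres mu v Lt xi = 0.
  rewrite /fres mulmx_sumr big1 // => k lek.
  by rewrite -scalemxAr mulmxA Pproj_act ltNge lek mul0mx scaler0.
apply/eqP; rewrite -subv0; apply/subvP => u; rewrite memv_cap memv0.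
move=> /andP[/mem_mxrange[w uw] uW].
have -> : u = Pproj M mu v Lt *m u by rewrite {2}uw mulmxA PP -uw.
suff /subvP/(_ u uW) : (W2 A M mu v Lambda Lt N <=
    lker (linfun (mulmx (Pproj M mu v Lt) : 'cV[R]_n2 -> 'cV[R]_n2)))%VS.
  by rewrite memv_ker lfunE.
apply/span_subvP => _ /allpairsP[[i j] [_ _ ->]] /=.
by rewrite memv_ker lfunE /= colE !mulmxA Pf !mul0mx.
Qed.

End Exterior.
End Checks.

(* Main.v *)
Require Import Defs.
From HB Require Import structures.
From mathcomp Require Import all_boot all_order all_algebra.
From mathcomp Require Import complex.
From mathcomp Require Import all_classical all_reals all_analysis.
From mathcomp Require Import ring lra.

Import Order.TTheory GRing.Theory Num.Theory.
Local Open Scope classical_set_scope.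
Local Open Scope ring_scope.

(** Since [C] is a Rayleigh-Ritz constant, some Ritz value satisfies the
estimate with [C * min_(w in V) ||x - w||_A ^ 2]; so one vector of [V] at
squared energy distance at most [C_M * K] from [x] is enough, where [K] is the
remaining factor of the bound.

Write [x = (x1, x2)].  The first component may be copied, and the error is then
measured in the norm of [A22].  The second block row of [A x = lambda M x]
reads [(A22 - lambda M22) x2 = (lambda M21 - A21) x1].  Expand
[x2 = \sum_k c_k v_k] in the exterior eigenvectors.  The part with
[mu_k < gamma Lambda] lies in the range of the projection.  For the other [k],
[c_k] is [(mu_k - lambda)^-1] times the coefficient of the right-hand side, and
for each node [xi_i] the space [W2] contains the vector with the factors
[(mu_k - xi_i)^-1] in place of [(mu_k - lambda)^-1].  Interpolating the
resolvent [xi |-> (mu - xi)^-1] at the nodes, with weights that depend on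
[lambda] only, leaves exactly the relative error [w lambda / w mu], where
[w t = \prod_i (t - xi_i)] ([resolvent_interpolation]).  Hence the error of the
approximation from [V2] has coefficients [c_k * w lambda / w mu_k]
([V2_approximation]).

Two bounds finish the proof.  First, [mu * (w lambda / w mu)^2 <= K] for all
[mu >= gamma Lambda] ([cheb_quotient_bound]): [w] is a scaled Chebyshev
polynomial on [[0, Lambda]], so that [|w lambda| <= 2 (Lambda / 4)^N], while
[w mu >= (mu - Lambda)^N].  Secondly, [\sum_k c_k^2 = x2^T M22 x2] is at most
[C_M * x^T M x = C_M] ([C_M_bound]): the least eigenvalue of
[I - M22^(-1/2) M12^T M11^-1 M12 M22^(-1/2)] bounds from below the ratio of the
Schur complement of [M11] to [M22], and the form of the Schur complement is the
minimum of that of [M] over the first block.  The square root of [M22] and the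
Rayleigh bound come from the functional calculus of real symmetric matrices
([symmetric_functional_calculus]). *)

(** * Interpolation of the resolvent *)

(** Lagrange interpolation at the points [s i], divided by the nodal
polynomial. *)
Lemma partial_fractions {F : fieldType} {N : nat} {s : 'I_N -> F} {p : {poly F}} :
  injective s -> (size p <= N)%N ->
  exists c : 'I_N -> F, forall m, (forall i, m != s i) ->
    \sum_i c i * (m - s i)^-1 = p.[m] / \prod_i (m - s i).
Proof.
move=> s_inj ps; pose c i := p.[s i] / \prod_(j | j != i) (s i - s j).
pose q i : {poly F} := \prod_(j | j != i) ('X - (s j)%:P).
have qE i m : (q i).[m] = \prod_(j | j != i) (m - s j).
  by rewrite horner_prod; apply: eq_bigr => j _; rewrite hornerXsubC.
have pE : p = \sum_i c i *: q i.
  apply/eqP; rewrite -subr_eq0; apply/eqP.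
  (* p and its interpolant have size at most N and agree at the N points s i. *)
  apply: (@roots_geq_poly_eq0 _ _ (codom s)).
  - apply/allP => _ /codomP[i ->]; apply/rootP.
    rewrite hornerD hornerN horner_sum (bigD1 i) //= big1 => [|j ji].
      rewrite hornerZ qE addr0 divfK ?subrr //.
      by apply/prodf_neq0 => j ji; rewrite subr_eq0 inj_eq // eq_sym.
    by rewrite hornerZ qE (bigD1 i) 1?eq_sym //= subrr mul0r mulr0.
  - by rewrite /codom /image_mem map_inj_uniq ?enum_uniq.
  - rewrite size_map -cardE card_ord (leq_trans (size_polyD _ _)) //.
    rewrite geq_max ps size_polyN; apply: (leq_trans (size_sum _ _ _)).
    apply/bigmax_leqP => i _; apply: (leq_trans (size_scale_leq _ _)).
    rewrite /q -big_filter size_prod_XsubC size_filter -sum1_count sum1_card.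
    by rewrite cardC1 card_ord prednK // (leq_ltn_trans _ (ltn_ord i)).
clearbody c; exists c => m ms; rewrite {1}pE horner_sum mulr_suml; apply: eq_bigr => i _.
rewrite hornerZ qE [X in _ = _ / X](bigD1 i) //= -mulrA; congr (_ * _).
rewrite invfM mulrCA divff ?mulr1 //.
by apply/prodf_neq0 => j _; rewrite subr_eq0.
Qed.

(** The error of interpolating [xi |-> (m - xi)^-1] is known exactly because
[q = (w - w(l)) / ('X - l)], with [w] the nodal polynomial, has degree below
[N]: the partial fractions of [q / w] are the interpolant.  It matters that the
weights [c] do not depend on [m]: the same weights then serve all exterior
eigenvalues at once. *)
Lemma resolvent_interpolation {F : fieldType} {N : nat} {s : 'I_N -> F} :
  injective s -> forall l : F,
  exists c : 'I_N -> F, forall m, m != l -> (forall i, m != s i) ->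
    (m - l)^-1 - \sum_i c i * (m - s i)^-1
      = \prod_i (l - s i) / \prod_i (m - s i) * (m - l)^-1.
Proof.
move=> s_inj l; pose w := \prod_i ('X - (s i)%:P).
have wE m : w.[m] = \prod_i (m - s i).
  by rewrite horner_prod; apply: eq_bigr => j _; rewrite hornerXsubC.
have /factor_theorem[q qE] : root (w - w.[l]%:P) l.
  by apply/rootP; rewrite !hornerE subrr.
have sq : (size q <= N)%N.
  have [->|q0] := eqVneq q 0; first by rewrite size_poly0.
  rewrite -ltnS; have := size_Mmonic q0 (monicXsubC l).
  rewrite -qE size_XsubC addn2 /= => <-; rewrite (leq_trans (size_polyD _ _)) //.
  rewrite size_polyN geq_max size_prod_XsubC [index_enum _]unlock -enumT size_enum_ord ltnSn.
  by rewrite (leq_trans (size_polyC_leq1 _)).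
have [c cE] := partial_fractions s_inj sq.
exists c => m ml ms; rewrite cE // -!wE.
have wm : w.[m] != 0 by rewrite wE; apply/prodf_neq0 => j _; rewrite subr_eq0.
have := congr1 (fun p => p.[m]) qE; rewrite !hornerE => h.
have ml' : m - l != 0 by rewrite subr_eq0.
have -> : q.[m] = (w.[m] - w.[l]) / (m - l) by rewrite h mulfK.
by field; rewrite ml' wm.
Qed.

(** * Chebyshev polynomials and nodes *)

Fixpoint chebT (R : nzRingType) (n : nat) : {poly R} :=
  if n isn't n'.+1 then 1 else
  if n' isn't n''.+1 then 'X else 2 *: 'X * chebT R n' - chebT R n''.

Lemma chebTSS (R : nzRingType) n :
  chebT R n.+2 = 2 *: 'X * chebT R n.+1 - chebT R n.
Proof. by []. Qed.

Lemma chebT_cos (R : realType) n (t : R) : (chebT R n).[cos t] = cos (n%:R * t).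
Proof.
elim/ltn_ind: n => -[|[|n]] IH; first by rewrite mul0r cos0 hornerC.
  by rewrite mul1r hornerX.
rewrite chebTSS !hornerE !IH //.
have -> : n.+2%:R * t = n.+1%:R * t + t by rewrite -natr1 mulrDl mul1r.
have -> : n%:R * t = n.+1%:R * t - t by rewrite -natr1 mulrDl mul1r addrK.
by rewrite cosB cosD; ring.
Qed.

Lemma size_lead_chebT (R : numDomainType) n :
  size (chebT R n.+1) = n.+2 /\ lead_coef (chebT R n.+1) = 2 ^+ n.
Proof.
have sX (p : {poly R}) : p != 0 -> size (2 *: 'X * p) = (size p).+1.
  by move=> p0; rewrite -scalerAl size_scale ?pnatr_eq0 // mulrC size_mulX.
elim/ltn_ind: n => -[_|n IH]; first by rewrite size_polyX lead_coefX.
have [sz lc] := IH n (ltnSn n).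
have p0 : chebT R n.+1 != 0 by rewrite -size_poly_eq0 sz.
have lt : (size (- chebT R n) < size (2 *: 'X * chebT R n.+1)%R)%N.
  rewrite size_polyN sX // sz; case: n IH {sz lc p0} => [|n] IH.
    by rewrite size_poly1.
  by have [-> _] := IH n (leqW (ltnSn n)).
rewrite chebTSS size_polyDl // lead_coefDl // sX // sz; split=> //.
by rewrite -scalerAl lead_coefZ mulrC lead_coefM lead_coefX mul1r lc exprSr.
Qed.

Definition cheb_angle (R : realType) (N i : nat) : R :=
  (2 * i.+1%:R - 1) / (2 * N%:R) * pi.

Lemma cheb_angle_itv (R : realType) {N} (i : 'I_N) :
  cheb_angle R N i \in `]0, pi[%R.
Proof.
have N0 : 0 < N%:R :> R by rewrite ltr0n (leq_ltn_trans _ (ltn_ord i)).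
have iN : i.+1%:R <= N%:R :> R by rewrite ler_nat.
have i1 : 1 <= i.+1%:R :> R by rewrite ler1n.
rewrite in_itv /= /cheb_angle; apply/andP; split.
  by rewrite mulr_gt0 ?pi_gt0 // divr_gt0; lra.
rewrite -[ltRHS]mul1r ltr_pM2r ?pi_gt0 // ltr_pdivrMr; lra.
Qed.

Lemma cheb_angle_inj (R : realType) N : injective (fun i : 'I_N => cheb_angle R N i).
Proof.
move=> i j /(mulIf (lt0r_neq0 (pi_gt0 R))) /mulIf h; apply/val_inj/eqP.
rewrite -eqSS -(eqr_nat R); apply/eqP.
have N0 : 0 < N%:R :> R by rewrite ltr0n (leq_ltn_trans _ (ltn_ord i)).
have /h : (2 * N%:R)^-1 != 0 :> R by rewrite invr_eq0 mulf_neq0 ?lt0r_neq0.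
lra.
Qed.

Lemma cos_cheb_angle_inj (R : realType) N :
  injective (fun i : 'I_N => cos (cheb_angle R N i)).
Proof.
move=> i j /cos_inj h; apply/cheb_angle_inj/h;
  by apply: subset_itv_oo_cc; apply: cheb_angle_itv.
Qed.

(** The nodes [cos (cheb_angle _ _ i)] are [n.+1] distinct roots of a polynomial
of degree [n.+1] with leading coefficient [2 ^+ n], which determines it. *)
Lemma prod_sub_cheb_node (R : realType) n (t : R) :
  \prod_(i < n.+1) (cos t - cos (cheb_angle R n.+1 i)) = cos (n.+1%:R * t) / 2 ^+ n.
Proof.
have [sz lc] := size_lead_chebT R n.
pose s := codom (fun i : 'I_n.+1 => cos (cheb_angle R n.+1 i)).
have pE : chebT R n.+1 = 2 ^+ n *: \prod_(z <- s) ('X - z%:P).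
  rewrite -lc; apply: all_roots_prod_XsubC.
  - by rewrite sz size_map -cardE card_ord.
  - apply/allP => _ /codomP[i ->]; apply/rootP; rewrite chebT_cos.
    have -> : n.+1%:R * cheb_angle R n.+1 i = pi *+ i + pi / 2.
      rewrite /cheb_angle -[pi *+ i]mulr_natl -natr1; field.
      by rewrite natr1 pnatr_eq0.
    (* The angle is an odd multiple of pi / 2, reached from pi / 2 by steps of pi. *)
    elim: (nat_of_ord i) => [|k IH]; first by rewrite mulr0n add0r cos_pihalf.
    by rewrite mulrSr addrAC cosDpi IH oppr0.
  - rewrite uniq_rootsE /s /codom /image_mem map_inj_uniq ?enum_uniq //.
    exact: cos_cheb_angle_inj.
rewrite -chebT_cos pE hornerZ mulrC mulKf ?expf_neq0 ?pnatr_eq0 //.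
rewrite horner_prod /s big_map big_enum /=; apply: eq_bigr => i _.
by rewrite hornerXsubC.
Qed.

Lemma cheb_node_itv {R : realType} {L : R} {N} (i : 'I_N) :
  0 < L -> 0 < cheb_node L i < L.
Proof.
move=> L0; have /andP[c1 c2] : -1 < cos (cheb_angle R N i) < 1.
  have := cheb_angle_itv R i; rewrite in_itv /= => /andP[a0 api].
  have aI : cheb_angle R N i \in `[0, pi] by rewrite in_itv /= !ltW.
  rewrite -cospi -[X in _ && (_ < X)]cos0 !ltr_cos ?api // in_itv /=.
    by rewrite pi_ge0 lexx.
  by rewrite lexx pi_ge0.
rewrite /cheb_node -/(cheb_angle R N i); apply/andP; split; nra.
Qed.

Lemma cheb_node_inj {R : realType} {L : R} (N : nat) :
  0 < L -> injective (@cheb_node R L N).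
Proof.
move=> L0 i j; rewrite /cheb_node -/(cheb_angle R N i) -/(cheb_angle R N j).
have L2 : L / 2 != 0 by rewrite lt0r_neq0 ?divr_gt0.
by move=> /(mulfI L2) /addrI /cos_cheb_angle_inj.
Qed.

(** In the variable [cos t], with [l = L / 2 * (1 + cos t)], the product is
[(L / 2) ^+ N * cos (N t) / 2 ^+ (N - 1)]. *)
Lemma cheb_prod_bound (R : realType) (L l : R) N :
  (0 < N)%N -> 0 < L -> 0 <= l <= L ->
  `|\prod_(i < N) (l - cheb_node L i)| <= 2 * (L / 4) ^+ N.
Proof.
case: N => // n _ L0 /andP[l0 lL]; pose y := 2 * l / L - 1.
have lE : l = L / 2 * (1 + y) by rewrite /y; field; rewrite lt0r_neq0.
have y1 : -1 <= y <= 1.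
  by rewrite /y; apply/andP; split; rewrite ?lerBrDr ?lerBlDr ?addNr ?divr_ge0 ?ler_pdivrMr //; lra.
have -> : \prod_(i < n.+1) (l - cheb_node L i) =
    \prod_(i < n.+1) (L / 2 * (cos (acos y) - cos (cheb_angle R n.+1 i))).
  apply: eq_bigr => i _; rewrite acosK ?in_itv //= {1}lE /cheb_node.
  by rewrite -/(cheb_angle R n.+1 i); ring.
rewrite big_split /= prod_sub_cheb_node prodr_const card_ord.
have c1 := cos_max (n.+1%:R * acos y).
have L20 : 0 <= L / 2 by rewrite divr_ge0 // ltW.
rewrite mulrA normrM normfV normrM !normrX (ger0_norm L20) (ger0_norm (ler0n _ 2)).
have -> : 2 * (L / 4) ^+ n.+1 = (L / 2) ^+ n.+1 / 2 ^+ n.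
  have -> : L / 4 = L / 2 / 2 by field.
  rewrite expr_div_n [2 ^+ n.+1]exprS; field.
  by rewrite expf_neq0 ?pnatr_eq0.
rewrite ler_pM2r ?invr_gt0 ?exprn_gt0 //; apply: ler_piMr => //.
exact: exprn_ge0.
Qed.

(** * Functional calculus of real symmetric matrices *)

Lemma dot_ge0 {R : realType} {n} (y : 'cV[R]_n) : 0 <= (y^T *m y) 0 0.
Proof. by rewrite mxE sumr_ge0 // => i _; rewrite mxE -expr2 sqr_ge0. Qed.

Lemma dot_eq0 {R : realType} {n} (y : 'cV[R]_n) : (y^T *m y) 0 0 = 0 -> y = 0.
Proof.
rewrite mxE => /psumr_eq0P h; apply/colP => i; apply/eqP; rewrite mxE.
by rewrite -sqrf_eq0 expr2 -(h _ i) ?mxE // => j _; rewrite mxE -expr2 sqr_ge0.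
Qed.

Lemma trmx_horner_mx (R : comNzRingType) n (S : 'M[R]_n.+1) p :
  (horner_mx S p)^T = horner_mx S^T p.
Proof.
elim/poly_ind: p => [|p c IH]; first by rewrite !rmorph0 trmx0.
rewrite !rmorphD !rmorphM /= !horner_mx_X !horner_mx_C linearD /=.
rewrite tr_scalar_mx trmx_mul IH; congr (_ + _).
exact/comm_mx_horner.
Qed.

(** The unitary diagonalisation of [S] over the complex numbers has real
eigenvalues [r i]; the weight [w y i] is the squared modulus of the [i]-th
coordinate of [y] in the eigenbasis.  In terms of [r] and [w], everything about
[S] that the sequel needs is a statement over the reals, with no complex
eigenvectors. *)
Lemma symmetric_functional_calculus {R : realType} {n : nat} {S : 'M[R]_n.+1} : S^T = S ->
  exists r : 'I_n.+1 -> R, exists w : 'cV[R]_n.+1 -> 'I_n.+1 -> R,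
  [/\ forall i, eigenvalue S (r i),
      forall y i, 0 <= w y i,
      forall p : {poly R}, (forall i, p.[r i] = 0) -> horner_mx S p = 0 &
      forall (p : {poly R}) y,
        (y^T *m horner_mx S p *m y) 0 0 = \sum_i p.[r i] * w y i].
Proof.
move=> symS; pose B := cplx_mx S.
have Breal : B \is a mxOver Num.real.
  by apply/mxOverP => i j; rewrite mxE; apply/complex_realP; exists (S i j).
have Bsym : B \is symmetricmx.
  apply/is_hermitianmxP; rewrite expr0 scale1r.
  by apply/matrixP => i j; rewrite !mxE -{1}symS mxE.
have Bherm := realsym_hermsym Bsym Breal.
have [P [d [Pu PV dreal BE]]] : exists (P : 'M[R[i]]_n.+1) (d : 'rV[R[i]]_n.+1),
    [/\ P \in unitmx, invmx P = (P ^t* )%sesqui,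
        forall i, d 0 i \is Num.real & B = invmx P *m diag_mx d *m P].
  exists (spectralmx B), (spectral_diag B); split.
  - exact: spectral_unit.
  - by rewrite invmx_unitary // spectral_unitarymx.
  - by move=> i; apply: (mxOverP (hermitian_spectral_diag_real Bherm)).
  - exact: (orthomx_spectralP (hermitian_normalmx Bherm)).
pose r i := complex.Re (d 0 i).
have rE i : real_complex R (r i) = d 0 i by rewrite /r RRe_real.
pose D p : 'M[R[i]]_n.+1 := diag_mx (\row_i real_complex R p.[r i]).
have pE p : cplx_mx (horner_mx S p) = invmx P *m D p *m P.
  have -> : cplx_mx (horner_mx S p) = horner_mx B (map_poly (real_complex R) p).
    exact: map_horner_mx.
  rewrite BE horner_mx_uconjC //.
  rewrite horner_mx_diag; congr (_ *m diag_mx _ *m _).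
  by apply/rowP => i; rewrite !mxE -rE horner_map.
exists r, (fun y i => ComplexField.Normc.normc ((P *m cplx_mx y) i 0) ^+ 2).
split.
- move=> i; suff : eigenvalue B (d 0 i) by rewrite -rE eigenvalue_map.
  apply/eigenvalueP; exists (row i P); last first.
    apply: contraTneq Pu => Pi0; rewrite -row_free_unit -kermx_eq0.
    apply/rowV0Pn; exists (delta_mx 0 i); first by apply/sub_kermxP; rewrite -rowE.
    by apply/eqP => /rowP/(_ i)/eqP; rewrite !mxE !eqxx oner_eq0.
  rewrite BE -row_mul !mulmxA mulmxV // mul1mx.
  apply/rowP => j; rewrite !mxE (bigD1 i) //= big1 => [|k ki].
    by rewrite !mxE eqxx mulr1n addr0.
  by rewrite !mxE eq_sym (negbTE ki) mul0r.
- by move=> y i; apply: sqr_ge0.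
- move=> p p0; apply: (map_mx_inj (f := real_complex R)).
  rewrite -/(cplx_mx _) pE (_ : D p = 0) ?mulmx0 ?mul0mx ?map_mx0 //.
  by apply/matrixP => i j; rewrite !mxE p0 mul0rn.
- move=> p y; apply: (@complexI R).
  set u := P *m cplx_mx y.
  have uE : cplx_mx y^T *m invmx P = (u ^t* )%sesqui.
    rewrite PV /u trmx_mul map_mxM /=; congr (_ *m _).
    apply/matrixP => i j; rewrite !mxE.
    by rewrite conj_Creal //; apply/complex_realP; exists (y j i).
  transitivity ((cplx_mx (y^T *m horner_mx S p *m y)) 0 0); first by rewrite [RHS]mxE.
  rewrite /cplx_mx !map_mxM -!/(cplx_mx _) pE !mulmxA uE -mulmxA -/u.
  rewrite mul_mx_diag mxE rmorph_sum; apply: eq_bigr => i _.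
  rewrite !mxE rmorphM mulrAC mulrC; congr (_ * _).
  by rewrite mulrC -normCK rmorphXn.
Qed.

Lemma poly_through {F : fieldType} (s : seq F) (f : F -> F) :
  exists p : {poly F}, forall a, a \in s -> p.[a] = f a.
Proof.
elim: s => [|a s [p pf]]; first by exists 0.
have [as_|aNs] := boolP (a \in s).
  by exists p => b; rewrite inE => /predU1P[->|]; apply: pf.
pose q := \prod_(b <- s) ('X - b%:P).
have qa : q.[a] != 0.
  by rewrite -/(root q a) root_prod_XsubC.
exists (p + ((f a - p.[a]) / q.[a]) *: q) => b; rewrite inE !hornerE.
move=> /predU1P[->|bs]; first by rewrite divfK // addrC subrK.
have /rootP-> : root q b by rewrite root_prod_XsubC.
by rewrite mulr0 addr0 pf.
Qed.

(** A polynomial [p] through the points [(r i, sqrt (r i))] gives a square root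
[p(S)] that is real and symmetric by construction, whatever the multiplicities
of the eigenvalues. *)
Lemma sqrtmx_spd {R : realType} {n} {S : 'M[R]_n} : spd S ->
  spd (sqrtmx S) /\ sqrtmx S *m sqrtmx S = S.
Proof.
move=> spdS; suff [T TP] : exists T, spd T /\ T *m T = S.
  by rewrite /sqrtmx; case: xgetP => [T' _ //|/(_ T)[]].
case: n => [|n] in S spdS *.
  exists 0; split; last by apply/matrixP => -[].
  split=> [|x]; first by apply/matrixP => -[].
  by rewrite [x]flatmx0 eqxx.
have [symS posS] := spdS.
have [r [w [r_eig w0 calc0 calc]]] := symmetric_functional_calculus symS.
have r0 i : 0 < r i.
  have /eigenvalueP[a aS a0] := r_eig i.
  have := posS a^T; rewrite trmx_eq0 trmxK aS -scalemxAl mxE => /(_ a0).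
  have := dot_ge0 a^T; rewrite trmxK; nra.
have [p pE] := poly_through (codom r) Num.sqrt.
have pr i : p.[r i] = Num.sqrt (r i) by apply: pE; apply: codom_f.
exists (horner_mx S p); split; last first.
  apply/eqP; rewrite -subr_eq0; apply/eqP.
  transitivity (horner_mx S (p * p - 'X)).
    by rewrite rmorphB rmorphM /= horner_mx_X.
  apply: calc0 => i.
  by rewrite !hornerE pr -expr2 sqr_sqrtr ?subrr // ltW.
split=> [|y y0]; first by rewrite trmx_horner_mx symS.
have yy : (y^T *m y) 0 0 = \sum_i w y i.
  have := calc 1 y; rewrite rmorph1 mulmx1 => ->.
  by apply: eq_bigr => i _; rewrite hornerC mul1r.
have wr i : 0 <= p.[r i] * w y i by rewrite pr mulr_ge0 ?sqrtr_ge0.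
rewrite calc lt_def sumr_ge0 // andbT; apply: contraNneq y0 => s0.
apply/eqP/dot_eq0; rewrite yy big1 // => i _; apply/eqP.
have h := psumr_eq0P (fun i _ => wr i) s0; have /eqP := h i isT.
by rewrite pr mulf_eq0 sqrtr_eq0 leNgt r0.
Qed.

(** All eigenvalues of [S] are real and positive, and there is one, so the set has
a minimum and [set_min] does not take its default value; the minimum is the
least [r i], and the claim is Rayleigh's bound. *)
Lemma set_min_eigenvalue {R : realType} {n} {S : 'M[R]_n} : spd S -> (0 < n)%N ->
  let m := set_min [set eta : R | 0 < eta /\ mx_spectrum S (real_complex R eta)] in
  0 < m /\ forall y : 'cV[R]_n, m * (y^T *m y) 0 0 <= (y^T *m S *m y) 0 0.
Proof.
case: n S => // n S [symS posS] _ m.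
have [r [w [r_eig w0 calc0 calc]]] := symmetric_functional_calculus symS.
have yy y : (y^T *m y) 0 0 = \sum_i w y i.
  have := calc 1 y; rewrite rmorph1 mulmx1 => ->.
  by apply: eq_bigr => i _; rewrite hornerC mul1r.
have ySy y : (y^T *m S *m y) 0 0 = \sum_i r i * w y i.
  have := calc 'X y; rewrite horner_mx_X => ->.
  by apply: eq_bigr => i _; rewrite hornerX.
have eig e : eigenvalue S e -> exists2 a : 'cV[R]_n.+1, a != 0 &
    (a^T *m S *m a) 0 0 = e * (a^T *m a) 0 0.
  move=> /eigenvalueP[a aS a0]; exists a^T; rewrite ?trmx_eq0 //.
  by rewrite trmxK aS -scalemxAl mxE.
have spE e : mx_spectrum S (real_complex R e) <-> eigenvalue S e.
  by rewrite /mx_spectrum /= /cplx_mx eigenvalue_map.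
have [i0 _ i0_min] := @arg_minP _ _ _ ord0 xpredT r isT.
have ray (y : 'cV[R]_n.+1) : r i0 * (y^T *m y) 0 0 <= (y^T *m S *m y) 0 0.
  by rewrite yy ySy mulr_sumr ler_sum // => i _; rewrite ler_wpM2r ?i0_min.
have epos e : eigenvalue S e -> 0 < e.
  move=> /eig[a a0 aS]; have := posS a a0; rewrite aS.
  have := dot_ge0 a; nra.
set X := [set eta : R | _] in m *.
have Xmin : X (r i0) /\ lbound X (r i0).
  split; first by split; [apply: epos|apply/spE].
  move=> e [_ /spE/eig[a a0 aS]]; have := ray a; rewrite aS.
  by rewrite ler_pM2r // lt_def dot_ge0 andbT; apply: contraNneq a0 => /dot_eq0 ->.
have [[m0 _] mlb] : X m /\ lbound X m.
  by rewrite /m /set_min; case: xgetP => [? _ //|/(_ (r i0))/(_ Xmin)].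
split=> // y; apply: le_trans (ray y); rewrite ler_wpM2r ?dot_ge0 //.
exact: (mlb _ Xmin.1).
Qed.
(** * Decay of the nodal quotient *)

(** With [q = L / (4 (m - L))] and [q0 = 1 / (4 (g - 1))], the left-hand side is
at most [4 m q ^ (2 N)].  One factor [q] is spent on [m q <= g L q0], the others
on [q <= q0]; this gives [4 g L q0 ^ (2 N)], and [4 g q0 = g / (g - 1) >= 1]
turns it into the stated, weaker form. *)
Lemma cheb_quotient_bound (R : realType) (L g l m : R) N :
  (0 < N)%N -> 0 < L -> 1 < g -> 0 <= l <= L -> g * L <= m ->
  m * (\prod_(i < N) (l - cheb_node L i) / \prod_(i < N) (m - cheb_node L i)) ^+ 2
    <= L * (4 * g) ^+ 3 * (1 / (4 * (g - 1))) ^+ (2 * N + 2).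
Proof.
move=> N0 L0 g1 lL gm.
have Lm : 0 < m - L by nra.
have m0 : 0 < m by lra.
set w := \prod_(i < N) _; set wm := \prod_(i < N) _.
have wb : `|w| <= 2 * (L / 4) ^+ N by apply: cheb_prod_bound.
have wmb : (m - L) ^+ N <= wm.
  rewrite -[N in X in X <= _]card_ord -prodr_const; apply: ler_prod => i _.
  by rewrite ltW // lerD2l lerN2 ltW //; case/andP: (cheb_node_itv i L0).
have wm0 : 0 < wm by apply: lt_le_trans wmb; rewrite exprn_gt0.
pose q := L / (4 * (m - L)); pose q0 := 1 / (4 * (g - 1)).
have q_ge0 : 0 <= q by rewrite divr_ge0 ?mulr_ge0 ?ltW.
have g10 : 0 < g - 1 by lra.
have q0_gt0 : 0 < q0 by rewrite divr_gt0 ?mulr_gt0.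
have qq0 : q <= q0.
  by rewrite /q /q0 ler_pdivrMr ?mulr_gt0 // mulrAC ler_pdivlMr ?mulr_gt0 //; nra.
have mq : m * q <= g * L * q0.
  rewrite /q /q0 !mulrA ler_pdivrMr ?mulr_gt0 // mulr1 mulrAC.
  by rewrite ler_pdivlMr ?mulr_gt0 //; nra.
have ratio : `|w / wm| <= 2 * q ^+ N.
  rewrite normrM normfV (gtr0_norm wm0) ler_pdivrMr //; apply: le_trans wb _.
  rewrite -mulrA ler_pM2l //; apply: le_trans (_ : q ^+ N * (m - L) ^+ N <= _).
    rewrite -exprMn /q le_eqVlt; apply/orP; left; apply/eqP; congr (_ ^+ _).
    by field; rewrite lt0r_neq0.
  by rewrite ler_wpM2l // exprn_ge0.
have step1 : m * (w / wm) ^+ 2 <= m * (2 * q ^+ N) ^+ 2.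
  apply: ler_wpM2l; first exact: ltW.
  by rewrite -real_normK ?num_real // ler_pXn2r ?nnegrE // mulr_ge0 ?exprn_ge0.
apply: le_trans step1 _.
have KE : (2 * N).-1.+1 = (2 * N)%N by rewrite prednK // muln_gt0.
have -> : m * (2 * q ^+ N) ^+ 2 = 4 * (m * q) * q ^+ (2 * N).-1.
  rewrite exprMn -exprM [(N * 2)%N]mulnC -[(2 * N)%N in LHS]KE [q ^+ _.+1]exprS; ring.
apply: le_trans (_ : 4 * (g * L * q0) * q0 ^+ (2 * N).-1 <= _).
  have mq0 : 0 <= m * q by rewrite mulr_ge0 // ltW.
  by apply: ler_pM; [lra|exact: exprn_ge0|lra|apply: lerXn2r; rewrite // nnegrE ltW].
have -> : 4 * (g * L * q0) * q0 ^+ (2 * N).-1 = 4 * g * L * q0 ^+ (2 * N).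
  by rewrite -[(2 * N)%N in RHS]KE [q0 ^+ _.+1]exprS; ring.
have gq0 : 1 <= 4 * g * q0.
  by rewrite /q0 mulrA mulr1 ler_pdivlMr ?mulr_gt0 //; lra.
have -> : L * (4 * g) ^+ 3 * (1 / (4 * (g - 1))) ^+ (2 * N + 2)
    = 4 * g * L * q0 ^+ (2 * N) * (4 * g * q0) ^+ 2 by rewrite -/q0 exprD; ring.
apply: ler_peMr; last exact: exprn_ege1.
by apply: mulr_ge0; [nra | rewrite exprn_ge0 // ltW].
Qed.

(** * Schur complements and the constant C_M *)

(** Nonnegativity makes the default value [0] harmless, so that no existence of a
minimum has to be shown. *)
Lemma set_min_le (R : realType) (X : set R) e :
  (forall a, X a -> 0 <= a) -> X e -> set_min X <= e.
Proof. by move=> X0 Xe; rewrite /set_min; case: xgetP => [? _ [_ ->]|_]//; exact: X0. Qed.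

Lemma spd_unitmx {R : realType} {n} {S : 'M[R]_n} : spd S -> S \in unitmx.
Proof.
move=> [symS posS]; rewrite -row_free_unit -kermx_eq0; apply/rowV0P => u.
move=> /sub_kermxP uS; apply/eqP; apply: contraTT isT => u0.
by have := posS u^T; rewrite trmx_eq0 trmxK uS mul0mx mxE ltxx => /(_ u0).
Qed.

Lemma spd_ge0 {R : realType} {n} {S : 'M[R]_n} (y : 'cV[R]_n) :
  spd S -> 0 <= (y^T *m S *m y) 0 0.
Proof.
move=> [_ posS]; have [->|/posS/ltW//] := eqVneq y 0.
by rewrite mulmx0 mxE.
Qed.

Lemma block_quad {R : comNzRingType} {n1 n2} (S : 'M[R]_(n1 + n2))
    (x1 : 'cV[R]_n1) (x2 : 'cV[R]_n2) :
  (col_mx x1 x2)^T *m S *m col_mx x1 x2 =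
    x1^T *m ulsubmx S *m x1 + x2^T *m dlsubmx S *m x1
      + (x1^T *m ursubmx S *m x2 + x2^T *m drsubmx S *m x2).
Proof.
rewrite -{1}[S]submxK tr_col_mx mul_row_block mul_row_col.
by rewrite !mulmxDl.
Qed.

Lemma sym_blocks {R : realType} {n1 n2} {S : 'M[R]_(n1 + n2)} : S^T = S ->
  [/\ (ulsubmx S)^T = ulsubmx S, dlsubmx S = (ursubmx S)^T &
      (drsubmx S)^T = drsubmx S].
Proof. by move=> symS; rewrite trmx_ulsub trmx_ursub trmx_drsub symS. Qed.

Lemma spd_ulsubmx {R : realType} {n1 n2} {S : 'M[R]_(n1 + n2)} :
  spd S -> spd (ulsubmx S).
Proof.
move=> [symS posS]; have [s1 _ _] := sym_blocks symS; split=> // y y0.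
have := posS (col_mx y 0); rewrite block_quad trmx0 !mul0mx !mulmx0 !addr0.
by apply; rewrite col_mx_eq0 negb_and y0.
Qed.

Lemma spd_drsubmx {R : realType} {n1 n2} {S : 'M[R]_(n1 + n2)} :
  spd S -> spd (drsubmx S).
Proof.
move=> [symS posS]; have [_ _ s2] := sym_blocks symS; split=> // y y0.
have := posS (col_mx 0 y); rewrite block_quad trmx0 !mul0mx !mulmx0 !add0r.
by apply; rewrite col_mx_eq0 negb_and y0 orbT.
Qed.

Definition schur_compl {R : realType} {n1 n2} (S : 'M[R]_(n1 + n2)) : 'M[R]_n2 :=
  drsubmx S - (ursubmx S)^T *m invmx (ulsubmx S) *m ursubmx S.

(** Completing the square in the first block. *)
Lemma schur_quad {R : realType} {n1 n2} {S : 'M[R]_(n1 + n2)} : spd S ->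
  forall (x1 : 'cV[R]_n1) (x2 : 'cV[R]_n2),
  let y := x1 + invmx (ulsubmx S) *m ursubmx S *m x2 in
  (col_mx x1 x2)^T *m S *m col_mx x1 x2 =
    y^T *m ulsubmx S *m y + x2^T *m schur_compl S *m x2.
Proof.
move=> spdS x1 x2 /=; have u := spd_unitmx (spd_ulsubmx spdS).
have [s1 s12 _] := sym_blocks spdS.1.
rewrite block_quad s12 /schur_compl.
set P := ulsubmx S in u s1 *; set B := ursubmx S; set D := drsubmx S.
have Pi : (invmx P)^T = invmx P by rewrite trmx_inv s1.
have -> : (x1 + invmx P *m B *m x2)^T *m P = x1^T *m P + x2^T *m B^T.
  by rewrite linearD /= !trmx_mul Pi mulmxDl !mulmxA mulmxKV.
rewrite mulmxBr mulmxBl !mulmxDl !mulmxDr !mulmxA mulmxK //.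
rewrite [in RHS]addrACA addrK -!addrA; congr (_ + _).
by rewrite addrC -addrA.
Qed.

(** The choice of [x1] that makes the square vanish in [schur_quad] turns the form
of the Schur complement into a value of the form of [S]. *)
Lemma schur_spd {R : realType} {n1 n2} {S : 'M[R]_(n1 + n2)} :
  spd S -> spd (schur_compl S).
Proof.
move=> spdS; have [s1 _ s2] := sym_blocks spdS.1; split=> [|x2 x20].
  by rewrite /schur_compl linearB /= !trmx_mul trmxK trmx_inv s1 s2 mulmxA.
have := spdS.2 (col_mx (- (invmx (ulsubmx S) *m ursubmx S *m x2)) x2).
rewrite schur_quad // addNr mulmx0 add0r; apply.
by rewrite col_mx_eq0 negb_and x20 orbT.
Qed.

(** The matrix in the definition of [C_M] is the Schur complement congruent by
[h = M22^(-1/2)]; at [y = M22^(1/2) x2] its form is that of the Schur complement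
at [x2], which is at most that of [M] at [x], whereas [y^T y = x2^T M22 x2]. *)
Lemma C_M_bound {R : realType} {n1 n2} {M : 'M[R]_(n1 + n2)} (spdM : spd M)
    (x : 'cV[R]_(n1 + n2)) :
  ((dsubmx x)^T *m drsubmx M *m dsubmx x) 0 0 <= C_M M * (x^T *m M *m x) 0 0.
Proof.
rewrite /C_M.
(* For n2 = 0 the spectrum is empty and C_M is 0, but both sides vanish. *)
have [n2_0|n2_gt0] := posnP n2.
  have -> : dsubmx x = 0 by apply/colP => i; have := ltn_ord i; rewrite {2}n2_0.
  rewrite mulmx0 mxE mulr_ge0 ?spd_ge0 // invr_ge0 /set_min.
  by case: xgetP => // e _ [[/ltW]].
have [[symT posT] TT] := sqrtmx_spd (spd_drsubmx spdM).
have uT := spd_unitmx (conj symT posT).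
set T := sqrtmx _ in symT posT TT uT *; set h := invmx T.
have hT : h^T = h by rewrite trmx_inv symT.
have hE : 1%:M - h *m (ursubmx M)^T *m invmx (ulsubmx M) *m ursubmx M *m h
    = h^T *m schur_compl M *m h.
  rewrite hT /schur_compl mulmxBr mulmxBl !mulmxA; congr (_ - _).
  by rewrite -TT mulmxA mulVmx // mul1mx mulmxV.
have spdH : spd (h^T *m schur_compl M *m h).
  have [s1 s2] := schur_spd spdM; split=> [|y y0].
    by rewrite !trmx_mul trmxK s1 mulmxA.
  have := s2 (h *m y); rewrite trmx_mul !mulmxA; apply.
  by apply: contraNneq y0 => hy; rewrite -[y](mulKVmx uT) -/h hy mulmx0.
rewrite hE; set m := set_min _.
have [m0 mb] : 0 < m /\ _ := set_min_eigenvalue spdH n2_gt0.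
rewrite ler_pdivlMl //; have := mb (T *m dsubmx x).
have -> : (T *m dsubmx x)^T *m (T *m dsubmx x)
    = (dsubmx x)^T *m drsubmx M *m dsubmx x.
  by rewrite trmx_mul symT -TT !mulmxA.
move=> /le_trans; apply.
have -> : (T *m dsubmx x)^T *m (h^T *m schur_compl M *m h) *m (T *m dsubmx x)
    = (dsubmx x)^T *m schur_compl M *m dsubmx x.
  by rewrite trmx_mul symT hT !mulmxA mulmxK // mulmxKV.
rewrite -[in leRHS](vsubmxK x) schur_quad // [in leRHS]mxE lerDr.
exact/spd_ge0/spd_ulsubmx.
Qed.
(** * Expansion in the exterior eigenvectors *)

Section ExteriorExpansion.
Variables (R : realType) (n1 n2 : nat) (A M : 'M[R]_(n1 + n2)).
Variables (mu : 'I_n2 -> R) (v : 'I_n2 -> 'cV[R]_n2).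
Hypothesis ext : exterior_eigenpairs A M mu v.

Let orth j k : (v j)^T *m drsubmx M *m v k = (j == k)%:R%:M.
Proof. by apply/matrixP => a b; rewrite !ord1 ext.2 mxE eqxx. Qed.

Definition ext_coef (y : 'cV[R]_n2) k : R := ((v k)^T *m drsubmx M *m y) 0 0.

Lemma ext_coefE y k : (v k)^T *m drsubmx M *m y = (ext_coef y k)%:M.
Proof. exact: mx11_scalar. Qed.

Lemma ext_expansion y : y = \sum_k ext_coef y k *: v k.
Proof.
have id1 : \sum_k v k *m ((v k)^T *m drsubmx M) = 1%:M.
  apply: (exterior_eq ext) => j; rewrite mulmx_suml (bigD1 j) //= big1 => [|k kj].
    by rewrite -mulmxA orth eqxx mulmx1 addr0 mul1mx.
  by rewrite -mulmxA orth (negbTE kj) mul_mx_scalar scale0r.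
rewrite -[LHS]mul1mx -id1 mulmx_suml; apply: eq_bigr => k _.
by rewrite -mulmxA ext_coefE mul_mx_scalar.
Qed.

(** Any [S] diagonal in the exterior eigenbasis: used with [s = mu] for [A22] and
with [s = 1] for [M22]. *)
Lemma ext_quad (S : 'M[R]_n2) (s a : 'I_n2 -> R) :
  (forall k, S *m v k = s k *: (drsubmx M *m v k)) ->
  let y := \sum_k a k *: v k in
  (y^T *m S *m y) 0 0 = \sum_k s k * a k ^+ 2.
Proof.
move=> Sv y.
have Sy : S *m y = \sum_k (a k * s k) *: (drsubmx M *m v k).
  by rewrite mulmx_sumr; apply: eq_bigr => k _; rewrite -scalemxAr Sv scalerA.
rewrite -mulmxA Sy mulmx_sumr summxE; apply: eq_bigr => k _.
rewrite -scalemxAr mxE mulmxA.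
rewrite /y linear_sum /= !mulmx_suml (bigD1 k) //= big1 => [|j jk].
  by rewrite addr0 linearZ /= -!scalemxAl orth eqxx !mxE /=; ring.
by rewrite linearZ /= -!scalemxAl orth (negbTE jk) mulr0n raddf0 scaler0.
Qed.

Lemma ext_norm_sq y : (y^T *m drsubmx M *m y) 0 0 = \sum_k ext_coef y k ^+ 2.
Proof.
rewrite {1 2}[y]ext_expansion (ext_quad _ (fun=> 1)) => [|k].
  by apply: eq_bigr => k _; rewrite mul1r.
by rewrite scale1r.
Qed.

End ExteriorExpansion.

Arguments ext_coef {R n1 n2} M v y k.
Arguments ext_expansion {R n1 n2 A M mu v} ext y.
Arguments ext_quad {R n1 n2 A M mu v} ext {S s} a.
Arguments ext_norm_sq {R n1 n2 A M mu v} ext y.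

(** * Approximation from the complementing subspace *)

Lemma mem_W2 {R : realType} {n1 n2} (A M : 'M[R]_(n1 + n2)) mu v (L Lt : R) N
    (i : 'I_N) (a b : 'cV[R]_n1) :
  fres mu v Lt (cheb_node L i) *m (dlsubmx M *m a + dlsubmx A *m b)
    \in W2 A M mu v L Lt N.
Proof.
rewrite -mul_row_col mulmxA; set B := _ *m row_mx _ _; set w := col_mx a b.
have -> : B *m w = \sum_j w j 0 *: col j B.
  apply/colP => k; rewrite mxE summxE; apply: eq_bigr => j _.
  by rewrite !mxE mulrC.
apply: rpred_sum => j _.
apply/rpredZ/memv_span/allpairsP; exists (i, j).
by rewrite !mem_enum.
Qed.

(** The second block row of the eigenvalue equation, tested with [v k]: the term
in brackets is [(l M21 - A21) x1 = (A22 - l M22) x2]. *)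
Lemma ext_coef_coupling {R : realType} {n1 n2} {A M : 'M[R]_(n1 + n2)} {mu v l x} :
  A^T = A -> M^T = M -> exterior_eigenpairs A M mu v ->
  A *m x = l *: (M *m x) -> forall k,
  ((v k)^T *m (dlsubmx M *m (l *: usubmx x) + dlsubmx A *m (- usubmx x))) 0 0
    = (mu k - l) * ext_coef M v (dsubmx x) k.
Proof.
move=> symA symM ext Ax k.
have [_ _ sA] := sym_blocks symA; have [_ _ sM] := sym_blocks symM.
have E2 : dlsubmx M *m (l *: usubmx x) + dlsubmx A *m (- usubmx x)
    = drsubmx A *m dsubmx x - l *: (drsubmx M *m dsubmx x).
  have := congr1 dsubmx Ax; rewrite linearZ /= -!mul_dsub_mx -[x]vsubmxK.
  rewrite -[dsubmx A]hsubmxK -[dsubmx M]hsubmxK !mul_row_col !col_mxKu !col_mxKd.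
  rewrite -!/(dlsubmx _) -!/(drsubmx _) scalerDr mulmxN -scalemxAr => h.
  have la : l *: (dlsubmx M *m usubmx x)
      = dlsubmx A *m usubmx x + drsubmx A *m dsubmx x - l *: (drsubmx M *m dsubmx x).
    by rewrite h addrK.
  by rewrite la addrAC [X in X - _ - _]addrC addrK.
rewrite E2 mulmxBr mulmxA mxE [X in _ + X]mxE -[_ *m drsubmx A]trmxK.
rewrite trmx_mul trmxK sA ext.1 linearZ /= trmx_mul sM.
rewrite -scalemxAl -scalemxAr mulmxA /ext_coef !mxE; ring.
Qed.
(** The modes below [g L] are reproduced by the projection.  The others are the
values at [l] of [xi |-> f(xi) (l M21 - A21) x1], where the coupling term is kept
at [l]; they are interpolated at the nodes with the scalar weights of
[resolvent_interpolation]. *)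
Lemma V2_approximation {R : realType} {n1 n2} {A M : 'M[R]_(n1 + n2)}
    {mu : 'I_n2 -> R} {v : 'I_n2 -> 'cV[R]_n2} {L g l : R} (N : nat) {x} :
  A^T = A -> M^T = M -> exterior_eigenpairs A M mu v -> (forall k, 0 < mu k) ->
  0 < L -> 1 < g -> l < L -> A *m x = l *: (M *m x) ->
  exists2 y, y \in V2 A M mu v L (g * L) N &
    dsubmx x - y = \sum_k
      (if mu k < g * L then 0
       else \prod_(i < N) (l - cheb_node L i) / \prod_(i < N) (mu k - cheb_node L i)
            * ext_coef M v (dsubmx x) k) *: v k.
Proof.
move=> symA symM ext mu0 L0 g1 lL Ax.
have [c cE] := resolvent_interpolation (cheb_node_inj N L0) l.
pose G := dlsubmx M *m (l *: usubmx x) + dlsubmx A *m (- usubmx x).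
pose e := ext_coef M v (dsubmx x).
have GE k : (v k)^T *m G = ((mu k - l) * e k)%:M.
  by rewrite [LHS]mx11_scalar /G (ext_coef_coupling symA symM ext Ax).
have fG s : fres mu v (g * L) s *m G
    = \sum_(k | g * L <= mu k) ((mu k - s)^-1 * ((mu k - l) * e k)) *: v k.
  rewrite /fres mulmx_suml; apply: eq_bigr => k _.
  by rewrite -scalemxAl -mulmxA GE mul_mx_scalar scalerA.
have PE : Pproj M mu v (g * L) *m dsubmx x = \sum_(k | mu k < g * L) e k *: v k.
  rewrite /Pproj mulmx_suml; apply: eq_big => [k|k _]; first by rewrite mu0.
  by rewrite -!mulmxA [_^T *m _]mulmxA ext_coefE mul_mx_scalar.
exists (Pproj M mu v (g * L) *m dsubmx x
        + \sum_i c i *: (fres mu v (g * L) (cheb_node L i) *m G)).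
  apply: memv_add; first by apply/mem_mxrange; exists (dsubmx x).
  by apply: rpred_sum => i _; apply/rpredZ/mem_W2.
rewrite {1}(ext_expansion ext (dsubmx x)) -/e PE.
under [X in _ - (_ + X)]eq_bigr => i _ do rewrite fG scaler_sumr.
rewrite exchange_big /= (bigID (fun k => mu k < g * L)) /=.
rewrite [RHS](bigID (fun k => mu k < g * L)) /= [X in _ = X + _]big1 => [|k ->]; last first.
  by rewrite scale0r.
rewrite opprD addrACA subrr !add0r.
under [X in _ - X]eq_bigl => k do rewrite leNgt.
rewrite -sumrB; apply: eq_bigr => k; rewrite -leNgt => gk; rewrite ltNge gk /= -/e.
have Lm : L < mu k by nra.
have ml : mu k - l != 0 by rewrite subr_eq0 gt_eqF // (lt_trans lL).
under eq_bigr => i _ do rewrite scalerA.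
rewrite -scaler_suml -scalerBl; congr (_ *: _).
transitivity (((mu k - l)^-1 - \sum_i c i * (mu k - cheb_node L i)^-1)
    * ((mu k - l) * e k)).
  rewrite [in RHS]mulrBl (mulKf ml) mulr_suml; congr (_ - _).
  by apply: eq_bigr => i _; rewrite mulrA.
rewrite cE; first by rewrite [LHS]mulrA divfK.
  by rewrite -subr_eq0.
move=> i; rewrite gt_eqF //; apply: lt_trans Lm.
by case/andP: (cheb_node_itv i L0).
Qed.

(** * The error bound *)

Theorem theorem4p4 (R : realType) (n1 n2 : nat) (A M : 'M[R]_(n1 + n2))
    (spdA : spd A) (spdM : spd M) (simpleAM : simple_spectrum A M)
    (mu : 'I_n2 -> R) (v : 'I_n2 -> 'cV[R]_n2)
    (ext : exterior_eigenpairs A M mu v)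
    (Lambda gamma : R) (Lambda_gt0 : 0 < Lambda) (gamma_gt1 : 1 < gamma)
    (N : nat) (N_ge1 : (1 <= N)%N)
    (V : {vspace 'cV[R]_(n1 + n2)})
    (V_def : V = full_by n1 (V2 A M mu v Lambda (gamma * Lambda) N))
    (lambda : R) (lambda_int : 0 < lambda < Lambda)
    (lambda_eig : pencil_spectrum A M (real_complex R lambda))
    (x : 'cV[R]_(n1 + n2)) (x_eig : A *m x = lambda *: (M *m x))
    (x_norm : (x^T *m M *m x) 0 0 = 1)
    (C : R) (C_ritz : ritz_constant A M V lambda x C) :
  exists2 z : R[i], pencil_spectrum_on V A M z &
    ComplexField.Normc.normc (real_complex R lambda - z) / lambda
      <= C_M M * C * Lambda * (4 * gamma) ^+ 3
         * (1 / (4 * (gamma - 1))) ^+ (2 * N + 2).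
Proof.
have [C0 [z zV zC]] := C_ritz; exists z => //; apply: le_trans zC _.
have /andP[l0 lL] := lambda_int.
have mu0 := exterior_mu_gt0 spdA ext.
pose K := Lambda * (4 * gamma) ^+ 3 * (1 / (4 * (gamma - 1))) ^+ (2 * N + 2).
have -> : C_M M * C * Lambda * (4 * gamma) ^+ 3
    * (1 / (4 * (gamma - 1))) ^+ (2 * N + 2) = C * (K * C_M M).
  by rewrite /K; ring.
rewrite ler_pM2l //.
have [y yV2 yE] := V2_approximation N spdA.1 spdM.1 ext mu0 Lambda_gt0 gamma_gt1 lL x_eig.
have wV : col_mx (usubmx x) y \in V by rewrite V_def mem_full_by.
pose e := ext_coef M v (dsubmx x).
have K0 : 0 <= K.
  rewrite /K; apply: mulr_ge0; first by rewrite mulr_ge0 ?exprn_ge0 ?mulr_ge0 ?ltW //; lra.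
  by rewrite exprn_ge0 // divr_ge0 // mulr_ge0 // subr_ge0 ltW.
apply: le_trans (_ : mxnorm A (x - col_mx (usubmx x) y) ^+ 2 <= _).
  apply: set_min_le; last by exists (col_mx (usubmx x) y).
  by move=> _ [w _ <-]; rewrite sqr_ge0.
have -> : x - col_mx (usubmx x) y = col_mx 0 (dsubmx x - y).
  by rewrite -{1}[x]vsubmxK opp_col_mx add_col_mx subrr.
rewrite sqr_sqrtr ?spd_ge0 // block_quad trmx0 !mul0mx !mulmx0 !add0r yE.
rewrite (ext_quad (s := mu) ext) => [|k]; last exact: ext.1.
have CM := C_M_bound spdM x; rewrite x_norm mulr1 in CM.
apply: le_trans (_ : K * \sum_k e k ^+ 2 <= _); last first.
  by rewrite ler_wpM2l // -(ext_norm_sq ext).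
rewrite mulr_sumr ler_sum // => k _; case: ltP => [_|gk].
  by rewrite expr0n mulr0 mulr_ge0 ?sqr_ge0.
rewrite exprMn mulrA ler_wpM2r ?sqr_ge0 //.
by apply: cheb_quotient_bound; rewrite // !ltW.
Qed.
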